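(* Let $G$ be a graph of order $n$ such that neither $G$ nor its complement $\overline{G}$ has an isolated vertex. Then $\gamma_{t}^{oi}(G)+\gamma_{t}^{oi}(\overline{G})=n-1$ if and only if $G\in\Phi$.
   Context: All graphs are finite and simple; $\overline{G}$ is the complement of $G$, and membership in families of graphs is up to isomorphism. For a graph $G$ without isolated vertices, a total outer-independent dominating set (TOID set) is a set $S\subseteq V(G)$ such that every vertex of $V(G)$ has at least one neighbor in $S$ and $V(G)\setminus S$ is an independent set. The TOID number $\gamma_{t}^{oi}(G)$ is the smallest cardinality of a TOID set of $G$. The family $\Phi$ consists of all graphs $G$ (of order $n$) obtained as follows. Consider a complete graph $K_p$ on $p$ vertices, $3\leq p\leq n-2$, and let $x\in V(K_p)$. Add a set $J$ of $n-p$ new vertices. Add some edges with one end point in $V(K_p)\setminus\{x\}$ and the other in $J$ (no other edges are added, so $J\cup\{x\}$ is independent), such that (i) every vertex in $J$ is adjacent to at least one vertex in $V(K_p)\setminus\{x\}$, and (ii) every vertex in $V(K_p)\setminus\{x\}$ is adjacent to at most $|J|-1$ vertices in $J$. *)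

(* Defs.v *)
From mathcomp Require Import all_boot.
Set Implicit Arguments.
Unset Strict Implicit.
Unset Printing Implicit Defensive.

Record sgraph := SGraph {
  vertex :> finType;
  adj : rel vertex;
  adj_sym : symmetric adj;
  adj_irrefl : irreflexive adj
}.
Arguments adj {s}.

Definition giso (G H : sgraph) : Prop :=
  exists2 f : G -> H, bijective f & forall u v : G, adj (f u) (f v) = adj u v.

Section Complement.
Variable G : sgraph.
Definition compl_rel : rel G := fun u v => (u != v) && ~~ adj u v.
Lemma compl_rel_sym : symmetric compl_rel.
Proof. by move=> u v; rewrite /compl_rel eq_sym adj_sym. Qed.
Lemma compl_rel_irrefl : irreflexive compl_rel.
Proof. by move=> u; rewrite /compl_rel eqxx. Qed.
Definition complement : sgraph := SGraph compl_rel_sym compl_rel_irrefl.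
End Complement.

Section Complete.
Variable p : nat.
Definition complete_rel : rel 'I_p := fun u v => u != v.
Lemma complete_rel_sym : symmetric complete_rel.
Proof. by move=> u v; rewrite /complete_rel eq_sym. Qed.
Lemma complete_rel_irrefl : irreflexive complete_rel.
Proof. by move=> u; rewrite /complete_rel eqxx. Qed.
Definition complete : sgraph := SGraph complete_rel_sym complete_rel_irrefl.
End Complete.

Section TOID.
Variable G : sgraph.

Definition isolated (v : G) : bool := [forall u, ~~ adj v u].
Definition no_isolated : Prop := forall v : G, ~~ isolated v.

Definition independent (A : {set G}) : bool :=
  [forall u in A, forall v in A, ~~ adj u v].

Definition toid (S : {set G}) : bool :=
  [forall v, exists u in S, adj v u] && independent (~: S).

(* The default [set: G] is a legitimate candidate (lemma toid_setT) as soon as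
   G has no isolated vertex; otherwise toid_number carries no meaning. *)
Definition toid_number : nat := #|[arg min_(S < [set: G] | toid S) #|S|]|.

Lemma toid_setT : no_isolated -> toid [set: G].
Proof.
move=> noiso; apply/andP; split.
  apply/forallP => v; move: (noiso v); rewrite negb_forall => /existsP[u].
  by rewrite negbK => uv; apply/existsP; exists u; rewrite inE.
by apply/forall_inP => u; rewrite !inE.
Qed.

Lemma toid_numberP : no_isolated ->
  (exists2 S : {set G}, toid S & #|S| = toid_number) /\
  (forall S : {set G}, toid S -> toid_number <= #|S|).
Proof.
move=> /toid_setT TT; rewrite /toid_number.
by case: arg_minnP => // S tS minS; split=> //; exists S.
Qed.
End TOID.

(* The graph H enlarged by the set J of new vertices: J is independent, the
   edges of H are kept, and F u j says that u in H and j in J are joined. *)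
Section AddVertices.
Variables (H : sgraph) (J : finType) (F : H -> J -> bool).
Definition add_rel : rel (H + J) := fun a b =>
  match a, b with
  | inl u, inl v => adj u v
  | inl u, inr j => F u j
  | inr j, inl u => F u j
  | inr _, inr _ => false
  end.
Lemma add_rel_sym : symmetric add_rel.
Proof. by case=> [u|i] [v|j] //=; rewrite adj_sym. Qed.
Lemma add_rel_irrefl : irreflexive add_rel.
Proof. by case=> [u|i] //=; rewrite adj_irrefl. Qed.
Definition add_vertices : sgraph := SGraph add_rel_sym add_rel_irrefl.
End AddVertices.

Definition Phi (G : sgraph) : Prop :=
  let n := #|G| in
  exists p : nat, 3 <= p <= n - 2 /\
  exists (x : complete p) (F : complete p -> 'I_(n - p) -> bool),
    [/\ forall j, F x j = false,
        forall j, exists2 u, u != x & F u j,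
        forall u, u != x -> #|[set j | F u j]| <= #|'I_(n - p)| - 1
      & giso G (add_vertices F)].

(* Main.v *)
Require Import Defs.
From mathcomp Require Import all_boot ssralg ssrint.
From mathcomp Require Import zify.

(** Let [S] be a TOID set of [G] and [T] a TOID set of its complement.  The set
    [~: S] is independent in [G] and [~: T] is a clique of [G], so they share
    at most one vertex; equivalently [S :|: T] misses at most one vertex
    ([toid_cover]), and the two TOID numbers add up to at least n - 1.  The
    value n - 1 is attained exactly when some such [S] and [T] are disjoint and
    miss exactly one vertex [x], that is, when [T = ~: (x |: S)] for some
    [x \notin S] ([toid_sum_attained]).

    The pairs [(x, S)] of this kind are exactly the presentations of [G] as a
    member of [Phi]: the clique K_p is [x |: S] and the set J is its complement.
    Independence of [~: S] says that J together with [x] is independent,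
    domination of J by [S] is condition (i), domination of [S] by J in the
    complement is condition (ii), and the bounds 3 <= p and p <= n - 2 say that
    [S] and J have at least two elements, as a totally dominating set of a
    nonempty graph must ([total_dom_gt1]). *)

(** * TOID sets of a graph and of its complement *)

Lemma toidP (G : sgraph) (S : {set G}) :
  reflect ((forall v, exists2 u, u \in S & adj v u) /\
           {in ~: S &, forall u v, ~~ adj u v}) (toid S).
Proof.
apply: (iffP andP) => -[dom ind]; split.
- by move=> v; have /exists_inP[u] := forallP dom v; exists u.
- by move=> u v uS vS; have /forall_inP := forall_inP ind u uS; apply.
- by apply/forallP => v; apply/exists_inP; have [u] := dom v; exists u.
- by apply/forall_inP => u uS; apply/forall_inP => v vS; apply: ind.
Qed.

(** A dominator of a vertex is itself dominated, by a vertex other than itself. *)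
Lemma total_dom_gt1 {G : sgraph} {S : {set G}} (x : G) :
  (forall v, exists2 u, u \in S & adj v u) -> 1 < #|S|.
Proof.
move=> dom; have [u uS _] := dom x; have [w wS uw] := dom u.
apply/card_gt1P; exists u, w; split=> //.
by apply: contraTneq uw => ->; rewrite adj_irrefl.
Qed.

(** Two distinct vertices outside both sets would be nonadjacent in [G] and in
    the complement of [G]. *)
Lemma toid_cover {G : sgraph} {S : {set G}} {T : {set complement G}} :
  toid S -> toid T -> #|~: (S :|: T)| <= 1.
Proof.
move=> /toidP[_ indS] /toidP[_ indT].
apply/card_le1_eqP => u v; rewrite !inE !negb_or => /andP[uS uT] /andP[vS vT].
have := indS u v; have := indT u v; rewrite !inE => /(_ uT vT) nc /(_ uS vS) na.
by move: nc; rewrite /= /compl_rel na andbT negbK => /eqP.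
Qed.

Lemma toid_sum_attained (G : sgraph) :
  no_isolated G -> no_isolated (complement G) ->
  toid_number G + toid_number (complement G) + 1 = #|G| <->
  exists x : G, exists S : {set G},
    [/\ x \notin S, toid S & toid (~: (x |: S) : {set complement G})].
Proof.
move=> /toid_numberP[[S tS <-] minS] /toid_numberP[[T tT <-] minT].
have cov := toid_cover tS tT.
have cST := cardsC (S :|: T); have cUI := cardsUI S T.
split=> [sum|[x [S' [xS' tS' tT']]]].
  (* The size equation leaves no slack: one missed vertex, empty overlap. *)
  have miss1 : #|~: (S :|: T)| = 1 by move: cST cUI cov sum => /=; lia.
  have disj : #|S :&: T| = 0 by move: cST cUI sum => /=; lia.
  have /eqP/cards1P[x Ex] := miss1; exists x, S.
  have : x \in ~: (S :|: T) by rewrite Ex inE.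
  rewrite !inE negb_or => /andP[xS xT]; split=> //.
  suff -> : ~: (x |: S) = T by [].
  apply/setP => v; have /setP/(_ v) := cards0_eq disj; have /setP/(_ v) := Ex.
  rewrite !inE; case: eqP => [->|_]; first by rewrite (negPf xT).
  by case: (v \in S); case: (v \in T).
have := minS _ tS'; have := minT _ tT'.
have := cardsC (x |: S'); rewrite cardsU1 xS' /=.
by move: cST cUI cov => /=; lia.
Qed.

(** * Presentations of members of Phi *)

Lemma giso_of_inverse {G H : sgraph} {g : H -> G} :
  bijective g -> (forall a b, adj (g a) (g b) = adj a b) -> giso G H.
Proof.
move=> [f gK fK] gadj; exists f; first by exists g.
by move=> u v; rewrite -gadj !fK.
Qed.

(** This turns condition (ii) into the existence of a non-neighbor.  The element
    [t] is there because of truncated subtraction: on an empty type the bound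
    would hold with no witness. *)
Lemma card_pred_le_predn {T : finType} (P : pred T) (t : T) :
  #|[set j | P j]| <= #|T| - 1 <-> exists j, ~~ P j.
Proof.
have T0 : 0 < #|T| by apply/card_gt0P; exists t.
have cP := cardsC [set j | P j].
split=> [le|[j nj]].
  have /card_gt0P[j] : 0 < #|~: [set j | P j]| by lia.
  by rewrite !inE; exists j.
have : 0 < #|~: [set j | P j]| by apply/card_gt0P; exists j; rewrite !inE.
lia.
Qed.

(** The clique and the new vertices in [Phi] are ordinal types, so the two parts
    of the split are numbered separately. *)
Lemma split_enum {T : finType} (C : {set T}) :
  exists2 g : 'I_#|C| + 'I_(#|T| - #|C|) -> T,
    bijective g & forall a, (g a \in C) = (if a is inl _ then true else false).
Proof.
have eC : #|T| - #|C| = #|~: C| by rewrite -(cardsC C) addKn.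
pose g (a : 'I_#|C| + 'I_(#|T| - #|C|)) : T :=
  match a with inl i => enum_val i | inr j => enum_val (cast_ord eC j) end.
have gC a : (g a \in C) = (if a is inl _ then true else false).
  case: a => i /=; first exact: enum_valP.
  by apply/negbTE; rewrite -in_setC; apply: enum_valP.
exists g => //; apply: inj_card_bij; last first.
  by rewrite card_sum !card_ord subnKC ?max_card.
move=> a b eg; have := gC a; rewrite eg gC.
case: a b eg => [i|i] [j|j] //= /enum_val_inj; first by move=> ->.
by move=> /cast_ord_inj ->.
Qed.

(** Domination is total, so a vertex of J has a neighbor in [S], a set that
    avoids [x], which is condition (i); in the complement a vertex of [S] has a
    neighbor in J, which is condition (ii). *)
Lemma Phi_of_toid_pair {G : sgraph} {x : G} {S : {set G}} :
  x \notin S -> toid S -> toid (~: (x |: S) : {set complement G}) -> Phi G.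
Proof.
move=> xS /toidP[domS indS] /toidP[domJ indJ].
have S2 := total_dom_gt1 x domS; have J2 := total_dom_gt1 (x : complement G) domJ.
have cC := cardsC (x |: S); have cS : #|x |: S| = #|S|.+1 by rewrite cardsU1 xS.
have [g gbij gC] := split_enum (x |: S); have [g' gK g'K] := gbij.
have injg := bij_inj gbij.
have [x0 gx0] : exists x0, g (inl x0) = x.
  have := gC (g' x); rewrite g'K setU11.
  by case E: (g' x) => [i|//] _; exists i; rewrite -E g'K.
have outS j : g (inr j) \in ~: S.
  by have := gC (inr j); rewrite !inE => /negbT; rewrite negb_or => /andP[].
exists #|x |: S|; split; first by move: cC J2 => /=; lia.
pose F (u : complete #|x |: S|) j := adj (g (inl u)) (g (inr j)).
exists x0, F; split.
- by move=> j; apply/negbTE/indS; rewrite ?gx0 ?outS // inE.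
- move=> j; have [u uS] := domS (g (inr j)); rewrite adj_sym.
  have := gC (g' u); rewrite g'K inE uS orbT -{2}(g'K u).
  case E: (g' u) => [i|//] _ ji; exists i => //.
  by apply: contraNneq xS => i0; rewrite -gx0 -i0 -E g'K.
- move=> u ux0; have [w wJ /andP[_ nuw]] := domJ (g (inl u)).
  rewrite in_setC in wJ; have := gC (g' w); rewrite g'K (negPf wJ).
  move: nuw; rewrite -{1}(g'K w); case: (g' w) => [i|j] //= nuj _.
  by apply/(card_pred_le_predn _ j); exists j.
apply: (@giso_of_inverse _ (add_vertices F) g) => //.
case=> [u|i] [v|j] //=.
(* Independence of x |: S in the complement makes it a clique of G. *)
- have := indJ (g (inl u)) (g (inl v)); rewrite !setCK !gC /= => /(_ isT isT).
  rewrite /compl_rel (inj_eq injg) {1}/eq_op /= /complete_rel.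
  case: eqP => [->|_] /=; first by rewrite adj_irrefl.
  by rewrite negbK.
- by rewrite adj_sym.
- by apply/negbTE/indS; apply: outS.
Qed.

(** The sets [S] = K_p minus [x] and J work: inside each of these parts, a vertex
    is dominated by another vertex of the part (in [G], respectively in the
    complement); across them, conditions (i) and (ii) provide a dominator; and
    [x] is joined to all of [S] and to none of J. *)
Lemma toid_pair_of_Phi {G : sgraph} : Phi G ->
  exists x : G, exists S : {set G},
    [/\ x \notin S, toid S & toid (~: (x |: S) : {set complement G})].
Proof.
move=> [p [/andP[p3 pn] [x [F [Fx Fdom Fle [f [g fK gK] fadj]]]]]].
have gadj a b : adj (g a) (g b) = adj a b by rewrite -fadj !gK.
pose S := [set v | if f v is inl u then u != x else false].
have SC v : (v \in g (inl x) |: S) = (if f v is inl _ then true else false).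
  rewrite !inE -(can2_eq fK gK).
  by case: (f v) => [u|j] //; rewrite {1}/eq_op /= orbN.
(* The bounds on p enter through this: K_p minus x and J have at least two
   vertices each, so every vertex of either part has a companion there. *)
have other m (i : 'I_m) (A : {set 'I_m}) : 1 < #|A| -> exists2 j, j \in A & j != i.
  move=> A1; have /card_gt0P[j] : 0 < #|A :\ i|.
    by move: A1; rewrite (cardsD1 i A); case: (i \in A) => // /ltnW.
  by rewrite !inE => /andP[ji jA]; exists j.
have J1 : 1 < #|[set: 'I_(#|G| - p)]| by rewrite cardsT card_ord; lia.
exists (g (inl x)), S; split; first by rewrite inE gK eqxx.
- apply/toidP; split=> [v|u v].
    rewrite -(fK v); case: (f v) => [u|j]; last first.
      by have [u ux Fuj] := Fdom j; exists (g (inl u)); rewrite ?inE ?gadj ?gK.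
    have [|w wx wu] := other p u [set~ (x : 'I_p)].
      by rewrite cardsC1 card_ord; case: (p) p3.
    exists (g (inl w)); rewrite ?gadj ?inE ?gK; first by rewrite !inE in wx.
    by rewrite /= /complete_rel eq_sym.
  rewrite !inE -fadj; case: (f u) (f v) => [a|i] [b|j] //=; rewrite ?negbK.
  + by move=> /eqP-> /eqP->; rewrite /complete_rel eqxx.
  + by move=> /eqP-> _; rewrite Fx.
  + by move=> _ /eqP->; rewrite Fx.
apply/toidP; split=> [v|u v]; last first.
  rewrite !setCK !SC /= /compl_rel -fadj -(can_eq fK).
  case: (f u) (f v) => [a|//] [b|//] _ _ /=.
  by rewrite /complete_rel {1}/eq_op /= negbK; case: (a == b).
have [j j_v] : exists j, (f v != inr j) && ~~ adj (f v) (inr j).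
  case: (f v) => [u|i] /=; last first.
    by have [j _ ji] := other _ i _ J1; exists j; rewrite andbT /eq_op /= eq_sym.
  have /card_gt0P[j0 _] := ltnW J1.
  have [->|ux] := eqVneq u x; first by exists j0; rewrite Fx.
  by have /(card_pred_le_predn _ j0)[j nFj] := Fle u ux; exists j.
exists (g (inr j)); first by rewrite in_setC SC gK.
by rewrite /= /compl_rel -(can2_eq fK gK) -fadj gK.
Qed.

Theorem theorem2p4 (G : sgraph) (n : nat) (hn : #|G| = n)
    (hG : no_isolated G) (hGc : no_isolated (complement G)) :
  ((toid_number G)%:Z + (toid_number (complement G))%:Z = n%:Z - 1)%R
  <-> Phi G.
Proof.
have sumE := toid_sum_attained _ hG hGc.
split=> [sum|/toid_pair_of_Phi/sumE sum]; last by lia.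
have /sumE[x [S [xS tS tJ]]] :
  toid_number G + toid_number (complement G) + 1 = #|G| by lia.
exact: Phi_of_toid_pair xS tS tJ.
Qed.
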